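(* Let $k$ be a field, let $\mathbf{X}\subset k^n$ be a nonempty finite set of distinct points, and let $I=I(\mathbf{X})=\{f\in k[x_1,\dots,x_n] : f(P)=0 \text{ for all } P\in\mathbf{X}\}$ be its ($0$-dimensional radical) vanishing ideal. Let $t_1,\dots,t_r$ be the elements of the minimal basis $G(I)$ of $T(I)$ with respect to the lexicographic order induced by $x_1<\dots<x_n$, and write $t_i=x_1^{d_1^{(i)}}\cdots x_n^{d_n^{(i)}}$ for $1\le i\le r$. Then there exist, for all $1\le i\le r$, $1\le m\le n$ and $1\le\delta\le d_m^{(i)}$, polynomials $$\gamma_{m\delta i}=x_m-g_{m\delta i}(x_1,\dots,x_{m-1}),\qquad g_{m\delta i}\in k[x_1,\dots,x_{m-1}],$$ such that the polynomials $$f_i=\prod_{m=1}^{n}\ \prod_{\delta=1}^{d_m^{(i)}}\gamma_{m\delta i},\qquad i=1,\dots,r,$$ form a minimal Groebner basis of $I$ with respect to the lexicographic order induced by $x_1<\dots<x_n$.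
   Context: The lexicographic order induced by $x_1<\dots<x_n$ on terms (monic monomials) is: $x_1^{a_1}\cdots x_n^{a_n}<x_1^{b_1}\cdots x_n^{b_n}$ iff there is $j$ with $a_j<b_j$ and $a_i=b_i$ for all $i>j$. For $f\neq 0$, $T(f)$ is its leading term. $T(I)=\{T(f): f\in I\setminus\{0\}\}$ is the semigroup ideal of leading terms of $I$, and $G(I)$ is its minimal basis, i.e. the set of terms of $T(I)$ that are minimal with respect to divisibility. A Groebner basis of $I$ is a set $G\subset I$ whose leading terms generate the semigroup ideal $T(I)$; it is minimal if no leading term of one of its members divides the leading term of another member. For $m=1$, $g_{1\delta i}$ is a constant in $k$; empty products equal $1$. *)

(* Defs.v *)
From mathcomp Require Import all_boot all_order all_algebra.
From mathcomp Require Export finmap.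
From mathcomp Require Export mpoly.

Set Implicit Arguments.
Unset Strict Implicit.
Unset Printing Implicit Defensive.

Import GRing.Theory.
Local Open Scope ring_scope.

(* Variables are numbered from 0: x_1, ..., x_n are 'X_0, ..., 'X_(n-1).      *)
(* A term (monic monomial) is an exponent vector u : 'X_{1..n}, and (u <= v)%MM *)
(* is divisibility. The order (_ <= _)%O of mpoly and its mlead are degrevlex, *)
(* so the lexicographic order and its leading term are defined here.          *)

Section LexOrder.
Variable n : nat.
Implicit Types a b c : 'X_{1..n}.

Definition lexlt a b : bool :=
  [exists j : 'I_n,
     (a j < b j)%N && [forall i : 'I_n, (j < i)%N ==> (a i == b i)]].

Definition lexmax a b : 'X_{1..n} := if lexlt a b then b else a.

Lemma lexltP a b :
  reflect (exists2 j : 'I_n, (a j < b j)%N &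
             forall i : 'I_n, (j < i)%N -> a i = b i)
          (lexlt a b).
Proof.
apply: (iffP existsP) => [[j /andP[ltj /forallP h]]|[j ltj h]]; exists j => //.
  by move=> i ltji; apply/eqP; apply: (implyP (h i)).
by rewrite ltj; apply/forallP => i; apply/implyP => /h ->.
Qed.

Arguments lexltP {a b}.

Lemma lexltxx a : lexlt a a = false.
Proof. by apply/lexltP => -[j]; rewrite ltnn. Qed.

Lemma lexlt_trans a b c : lexlt a b -> lexlt b c -> lexlt a c.
Proof.
move=> /lexltP[j ltj hj] /lexltP[l ltl hl]; apply/lexltP.
have [ltjl|ltlj|eqjl] := ltngtP j l.
- exists l; first by rewrite (hj _ ltjl).
  by move=> i ltli; rewrite hj ?hl // (ltn_trans ltjl).
- exists j; first by rewrite -(hl _ ltlj).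
  by move=> i ltji; rewrite hj ?hl // (ltn_trans ltlj).
- have {}eqjl := val_inj eqjl; subst l.
  exists j; first exact: ltn_trans ltl.
  by move=> i ltji; rewrite hj ?hl.
Qed.

Lemma lexlt_total a b : a != b -> lexlt a b || lexlt b a.
Proof.
move=> neq_ab.
have /existsP[j0 Pj0] : [exists j, a j != b j].
  apply: contraNT neq_ab; rewrite negb_exists => /forallP h.
  by apply/eqP/mnmP => i; apply/eqP; rewrite -[_ == _]negbK.
case: (@arg_maxnP _ j0 (fun j => a j != b j) val Pj0) => j Pj maxj.
have eqab (i : 'I_n) : (j < i)%N -> a i = b i.
  by move=> ltji; apply: contraTeq ltji => /maxj; rewrite -leqNgt.
move: Pj; rewrite neq_ltn => /orP[ltj|ltj]; apply/orP; [left|right];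
  by apply/lexltP; exists j => // i /eqab.
Qed.

Lemma lexlt0 a : lexlt a 0%MM = false.
Proof. by apply/lexltP => -[j]; rewrite mnm0E ltn0. Qed.

End LexOrder.

(* The term 0%MM (that is, 1) is the least one, so it is a neutral starting   *)
(* value for the maximum; it is also the junk value for p = 0.                *)
Definition lexlead (n : nat) (R : nzRingType) (p : {mpoly R[n]}) : 'X_{1..n} :=
  \big[@lexmax n/0%MM]_(u <- msupp p) u.

Lemma lexlead_max (n : nat) (R : nzRingType) (p : {mpoly R[n]}) (u : 'X_{1..n}) :
  u \in msupp p -> u != lexlead p -> lexlt u (lexlead p).
Proof.
rewrite /lexlead; elim: (msupp p) => [//|v s IHs].
rewrite big_cons inE {1 3}/lexmax.
set w := \big[_/_]_(x <- s) x in IHs *.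
case: ifP => ltvw /orP[/eqP->//|us] neq.
- exact: IHs.
- by rewrite eqxx in neq.
have [eq_uw|neq_uw] := eqVneq u w; last first.
  have ltuw := IHs us neq_uw.
  have [eq_vw|neq_vw] := eqVneq v w; first by rewrite eq_vw.
  apply: lexlt_trans ltuw _.
  by move: (lexlt_total neq_vw); rewrite ltvw.
by move: (lexlt_total neq); rewrite eq_uw ltvw orbF.
Qed.

Lemma lexlead_supp (n : nat) (R : nzRingType) (p : {mpoly R[n]}) :
  p != 0 -> lexlead p \in msupp p.
Proof.
rewrite -msupp_eq0 /lexlead; case: (msupp p) => [//|v s] _.
elim: s v => [|w s IHs] v; first by rewrite big_cons big_nil /lexmax lexlt0 inE.
rewrite big_cons {1}/lexmax inE; case: ifP => _; last by rewrite eqxx.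
by rewrite IHs orbT.
Qed.

Section Groebner.
Variables (n : nat) (k : fieldType).
Implicit Types (X : {fset 'rV[k]_n}) (f g : {mpoly k[n]}) (u v : 'X_{1..n}).

Definition vanishing_ideal X f : Prop :=
  forall P : 'rV[k]_n, P \in X -> f.@[fun i => P 0 i] = 0.

(* For an ideal I, lead_terms I is T(I). *)
Definition lead_terms (S : {mpoly k[n]} -> Prop) u : Prop :=
  exists f, [/\ S f, f != 0 & lexlead f = u].

Definition semigroup_ideal_of (S : 'X_{1..n} -> Prop) u : Prop :=
  exists2 v, S v & (v <= u)%MM.

Definition minimal_basis (S : 'X_{1..n} -> Prop) u : Prop :=
  S u /\ forall v, S v -> (v <= u)%MM -> v = u.

(* Members are required to be nonzero, since their leading terms are used.    *)
Definition groebner_basis (I G : {mpoly k[n]} -> Prop) : Prop :=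
  (forall g, G g -> I g /\ g != 0) /\
  (forall u, semigroup_ideal_of (lead_terms G) u <-> lead_terms I u).

Definition minimal_groebner_basis (I G : {mpoly k[n]} -> Prop) : Prop :=
  groebner_basis I G /\
  (forall g h, G g -> G h -> g <> h -> ~~ (lexlead g <= lexlead h)%MM).

(* g involves only the variables 'X_j with j < m. *)
Definition in_first_variables (m : nat) g : Prop :=
  forall u, u \in msupp g -> forall j : 'I_n, (m <= j)%N -> u j = 0%N.

End Groebner.

(* Main.v *)
(* A polynomial of the required shape has leading term t_i automatically, so it
   suffices to find, for every c in I with leading term x^u, one with exponents
   u that vanishes on X. View c as a polynomial in its last variable x_m, of
   degree d = u_m. At a point of X whose fibre over its first m - 1 coordinates
   has more than d elements, the top coefficient of c vanishes; its leading term
   is x^u without x_m, so by induction factors in the earlier variables vanish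
   at all these points. Over the remaining points, d functions of the first
   m - 1 coordinates run through the whole fibre, and they can be interpolated
   by polynomials. *)
Require Import Defs.
From Stdlib Require Import Classical.
From mathcomp Require Import all_boot all_order all_algebra.

Set Implicit Arguments.
Unset Strict Implicit.
Unset Printing Implicit Defensive.

Import GRing.Theory.
Local Open Scope ring_scope.

(** * Multiplicativity of lexicographic leading terms *)

Section LexLead.
Variables (n : nat) (k : fieldType).
Implicit Types (a b c u v : 'X_{1..n}) (p q : {mpoly k[n]}).

Lemma lexltD2r a b c : lexlt (a + c)%MM (b + c)%MM = lexlt a b.
Proof.
apply: eq_existsb => j; rewrite !mnmDE ltn_add2r; congr (_ && _).
by apply: eq_forallb => i; rewrite !mnmDE eqn_add2r.
Qed.

(** The hypotheses encode weak inequalities. By translation invariance one summand can be raised at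
    a time, and the result is strict as soon as one step is. *)
Lemma lexltD a b u v :
    (a != u -> lexlt a u) -> (b != v -> lexlt b v) ->
  (a, b) != (u, v) -> lexlt (a + b)%MM (u + v)%MM.
Proof.
move=> ltau ltbv; have [->|/ltau lt1] := eqVneq a u.
  rewrite xpair_eqE eqxx /= => /ltbv.
  by rewrite ![(u + _)%MM]addmC lexltD2r.
move=> _; have [->|/ltbv lt2] := eqVneq b v; first by rewrite lexltD2r.
apply: (@lexlt_trans _ _ (u + b)%MM); first by rewrite lexltD2r.
by rewrite ![(u + _)%MM]addmC lexltD2r.
Qed.

Lemma lexlead_eq p u :
    u \in msupp p -> (forall v, v \in msupp p -> v != u -> lexlt v u) ->
  lexlead p = u.
Proof.
move=> up ltu; apply/eqP; apply/negPn/negP => neq.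
have lead_p : lexlead p \in msupp p.
  by apply: lexlead_supp; apply: contraTneq up => ->; rewrite msupp0.
have lt1 := ltu _ lead_p neq; rewrite eq_sym in neq.
by have := lexlt_trans lt1 (lexlead_max up neq); rewrite lexltxx.
Qed.

Lemma lexleadM p q :
  p != 0 -> q != 0 -> lexlead (p * q) = (lexlead p + lexlead q)%MM.
Proof.
move=> p0 q0; set u := lexlead p; set v := lexlead q.
have [up vq] : u \in msupp p /\ v \in msupp q by split; apply: lexlead_supp.
have ltD a b : a \in msupp p -> b \in msupp q -> (a, b) != (u, v) ->
    lexlt (a + b)%MM (u + v)%MM.
  by move=> ap bq; apply: lexltD; apply: lexlead_max.
apply: lexlead_eq => [|w /msuppM_le /allpairsP[[a b] /= [ap bq ->]] neq].
  rewrite mcoeff_msupp mpolyME raddf_sum /=.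
  (* Only the pair of leading terms contributes to the coefficient of [u + v], which is thus a
     product of two nonzero scalars. *)
  rewrite (bigD1_seq (u, v)) /=; first last.
  - by rewrite allpairs_uniq ?msupp_uniq // => -[? ?] [? ?].
  - by apply/allpairsP; exists (u, v).
  rewrite [X in _ + X]big_seq_cond [X in _ + X]big1 => [|[a b] /=].
    rewrite addr0 mcoeffZ mcoeffX eqxx mulr1 mulf_neq0 //.
    - by rewrite -mcoeff_msupp.
    - by rewrite -mcoeff_msupp.
  case/andP=> /allpairsP[[a' b'] /= [ap bq [-> ->]]] /(ltD _ _ ap bq) lt_ab.
  rewrite mcoeffZ mcoeffX; case: eqVneq lt_ab => [->|]; last by rewrite mulr0.
  by rewrite lexltxx.
by apply: ltD => //; apply: contraNneq neq => -[-> ->].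
Qed.

Lemma lexlead_prod (I : Type) (s : seq I) (F : I -> {mpoly k[n]}) :
    (forall i, F i != 0) ->
  lexlead (\prod_(i <- s) F i) = (\sum_(i <- s) lexlead (F i))%MM.
Proof.
move=> F0; elim: s => [|i s IHs].
  rewrite !big_nil; apply: lexlead_eq => [|v]; rewrite msupp1 mem_seq1 //.
  by move=> ->.
rewrite !big_cons lexleadM ?IHs //.
by elim/big_ind: _ => // [|x y]; [exact: oner_neq0 | exact: mulf_neq0].
Qed.

End LexLead.

(** * Separation and interpolation of points by polynomials in the first variables *)

Section FirstVariables.
Variables (n : nat) (k : fieldType).
Implicit Types (p q : {mpoly k[n]}) (P Q : 'rV[k]_n) (s : seq 'rV[k]_n).

Lemma in_first_variablesC m (a : k) : in_first_variables m (a%:MP_[n]).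
Proof.
move=> u; rewrite msuppC; case: ifP => // _; rewrite mem_seq1 => /eqP-> j _.
exact: mnm0E.
Qed.

Lemma in_first_variablesX m (i : 'I_n) :
  (i < m)%N -> in_first_variables m ('X_i : {mpoly k[n]}).
Proof.
move=> lt_im u; rewrite msuppX mem_seq1 => /eqP-> j le_mj.
by rewrite mnm1E; case: eqVneq le_mj => // <-; rewrite leqNgt lt_im.
Qed.

Lemma in_first_variablesB m p q :
    in_first_variables m p -> in_first_variables m q ->
  in_first_variables m (p - q).
Proof.
move=> hp hq u /msuppB_le; rewrite mem_cat => /orP[/hp|/hq]; exact.
Qed.

Lemma in_first_variablesD m p q :
    in_first_variables m p -> in_first_variables m q ->
  in_first_variables m (p + q).
Proof.
move=> hp hq u /msuppD_le; rewrite mem_cat => /orP[/hp|/hq]; exact.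
Qed.

Lemma in_first_variablesM m p q :
    in_first_variables m p -> in_first_variables m q ->
  in_first_variables m (p * q).
Proof.
move=> hp hq u /msuppM_le/allpairsP[[a b] /= [/hp ha /hq hb ->]] j le_mj.
by rewrite mnmDE ha ?hb.
Qed.

(** Its classes are the fibres of the projection to the first [m] coordinates. *)
Definition agree m P Q := [forall j : 'I_n, (j < m)%N ==> (P 0 j == Q 0 j)].

Lemma agreeP m P Q :
  reflect (forall j : 'I_n, (j < m)%N -> P 0 j = Q 0 j) (agree m P Q).
Proof.
by apply: (iffP forallP) => h j; [move/(implyP (h j))/eqP|apply/implyP => /h->].
Qed.

Lemma agree_refl m P : agree m P P.
Proof. exact/agreeP. Qed.

Lemma agree_trans m P Q : agree m P Q -> agree m Q =1 agree m P.
Proof.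
move=> /agreeP PQ S; apply/agreeP/agreeP => h j ltj.
  by rewrite PQ ?h.
by rewrite -PQ ?h.
Qed.

Lemma meval_first m p (x y : 'I_n -> k) :
    in_first_variables m p -> (forall j : 'I_n, (j < m)%N -> x j = y j) ->
  p.@[x] = p.@[y].
Proof.
move=> hp xy; rewrite !mevalE; apply: eq_big_seq => u /hp hu.
congr (_ * _); apply: eq_bigr => j _.
by have [/xy->|/hu->] := ltnP j m.
Qed.

Lemma separator m P Q : exists L, in_first_variables m L /\
  (~~ agree m P Q ->
    L.@[fun i => P 0 i] = 1 /\ L.@[fun i => Q 0 i] = 0).
Proof.
have [_|] := boolP (agree m P Q).
  by exists 0; split=> //; rewrite -mpolyC0; exact: in_first_variablesC.
rewrite negb_forall => /existsP[j]; rewrite negb_imply => /andP[ltj neq].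
(* A linear polynomial in a coordinate where the points differ, normalised to be 1 at [P]. *)
exists ((P 0 j - Q 0 j)^-1%:MP_[n] * ('X_j - (Q 0 j)%:MP_[n])); split.
  apply: in_first_variablesM; first exact: in_first_variablesC.
  apply: in_first_variablesB; last exact: in_first_variablesC.
  exact: in_first_variablesX.
move=> _; rewrite !mevalM !mevalB !mevalC !mevalXU subrr mulr0; split=> //.
by rewrite mulVf // subr_eq0.
Qed.

Lemma separator_seq m P s : exists L, [/\ in_first_variables m L,
    L.@[fun i => P 0 i] = 1
  & forall Q, Q \in s -> ~~ agree m P Q -> L.@[fun i => Q 0 i] = 0].
Proof.
elim: s => [|Q s [L [hL LP Ls]]].
  exists 1; rewrite meval1; split=> //.
  by rewrite -mpolyC1; exact: in_first_variablesC.
have [agrPQ|nagrPQ] := boolP (agree m P Q).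
  exists L; split=> // S; rewrite inE => /orP[/eqP->|]; last exact: Ls.
  by rewrite agrPQ.
have [M [hM /(_ nagrPQ)[MP MQ]]] := separator m P Q.
exists (M * L); split; first exact: in_first_variablesM.
  by rewrite mevalM MP LP mulr1.
move=> S; rewrite inE mevalM => /orP[/eqP->|Ss nPS].
  by rewrite MQ mul0r.
by rewrite Ls ?mulr0.
Qed.

(** Newton-style induction: each new point adds a correction that is zero at the points already
    treated. *)
Lemma interpolation m s (F : 'rV[k]_n -> k) :
    (forall P Q, agree m P Q -> F P = F Q) ->
  exists g, in_first_variables m g /\
            forall P, P \in s -> g.@[fun i => P 0 i] = F P.
Proof.
move=> F_agree; elim: s => [|P s [g [hg gs]]].
  by exists 0; split=> //; rewrite -mpolyC0; exact: in_first_variablesC.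
have [L [hL LP Ls]] := separator_seq m P s.
exists (g + (F P - g.@[fun i => P 0 i])%:MP_[n] * L); split.
  apply: in_first_variablesD hg _.
  by apply: in_first_variablesM hL; exact: in_first_variablesC.
move=> Q; rewrite inE mevalD mevalM mevalC => /orP[/eqP->|Qs].
  by rewrite LP mulr1 addrC subrK.
(* If [Q] agrees with [P], the correction is zero because [g] already takes the value [F Q = F P] at
   [P]. *)
have [PQ|/(Ls _ Qs)->] := boolP (agree m P Q); last by rewrite mulr0 addr0 gs.
rewrite (meval_first (y := fun i => Q 0 i) hg); last exact/agreeP.
by rewrite gs // (F_agree _ _ PQ) subrr mul0r addr0.
Qed.

End FirstVariables.

(** * The top coefficient of a polynomial in its last variable *)

Section TopCoefficient.
Variables (n : nat) (k : fieldType) (m : 'I_n) (c : {mpoly k[n]}).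
Hypotheses (c_first : in_first_variables m.+1 c) (c_neq0 : c != 0).

Let d := lexlead c m.
Let e : 'X_{1..n} := (U_(m) *+ d)%MM.

(** The coefficient of ['X_m ^+ d] in [c]: subtracting [e] deletes the variable [m] from each
    selected term. *)
Definition top_coef : {mpoly k[n]} :=
  \sum_(v <- msupp c | v m == d) c@_v *: 'X_[v - e].

Let eE i : e i = (if i == m then d else 0)%N.
Proof. by rewrite mulmnE mnm1E eq_sym; case: eqP; rewrite ?mul1n ?mul0n. Qed.

Let le_e (v : 'X_{1..n}) : v m = d -> (e <= v)%MM.
Proof.
by move=> vm; apply/mnm_lepP => i; rewrite eE; case: eqP => // ->; rewrite vm.
Qed.

Let lead_c : lexlead c \in msupp c.
Proof. exact: lexlead_supp. Qed.

Lemma msupp_top_coef w : w \in msupp top_coef ->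
  exists v, [/\ v \in msupp c, v m = d & w = (v - e)%MM].
Proof.
move=> /msupp_sum_le/flattenP[ss /mapP[v]].
rewrite mem_filter => /andP[/eqP vm vc] ->.
by move=> /msuppZ_le; rewrite msuppX mem_seq1 => /eqP->; exists v.
Qed.

(** Subtracting [e] is injective on the terms of exponent [d] in [m], so nothing cancels the leading
    coefficient. *)
Lemma top_coef_supp_lead : (lexlead c - e)%MM \in msupp top_coef.
Proof.
rewrite mcoeff_msupp raddf_sum /= big_mkcond.
rewrite (bigD1_seq (lexlead c)) ?msupp_uniq //=.
rewrite big1 => [|v /negPf neq]; last first.
  case: eqP => // /le_e le_ev; rewrite mcoeffZ mcoeffX.
  case: eqP => [eq_ve|_]; last by rewrite mulr0.
  by rewrite -(submK le_ev) eq_ve submK ?eqxx ?le_e in neq.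
by rewrite eqxx addr0 mcoeffZ mcoeffX eqxx mulr1 -mcoeff_msupp.
Qed.

Lemma top_coef_neq0 : top_coef != 0.
Proof. by apply: contraTneq top_coef_supp_lead => ->; rewrite msupp0. Qed.

Lemma lexlead_top_coef : lexlead top_coef = (lexlead c - e)%MM.
Proof.
apply: lexlead_eq top_coef_supp_lead _ => _ /msupp_top_coef[v [vc vm ->]] neq.
rewrite -(lexltD2r _ _ e) !submK ?le_e //; apply: lexlead_max => //.
by apply: contraNneq neq => ->.
Qed.

Lemma top_coef_first : in_first_variables m top_coef.
Proof.
move=> _ /msupp_top_coef[v [vc vm ->]] j; rewrite mnmBE eE leq_eqVlt.
case/orP=> [/eqP/val_inj<-|ltmj]; first by rewrite eqxx vm subnn.
by rewrite (c_first vc).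
Qed.

(** No variable after [m] occurs in [c], so the order compares the exponents of [m] first. *)
Lemma leq_lexlead_top v : v \in msupp c -> (v m <= d)%N.
Proof.
move=> vc; have [->//|neq] := eqVneq v (lexlead c).
have /lexltP[j ltj eqj] := lexlead_max vc neq.
have [lt_jm|lt_mj|/val_inj eq_jm] := ltngtP j m.
- by rewrite eqj.
- by rewrite (c_first lead_c) in ltj.
- by rewrite -eq_jm ltnW // /d -eq_jm.
Qed.

(** Specialising the other variables makes root counting in one variable available. *)
Lemma top_coef_univariate (x : 'I_n -> k) : exists q : {poly k},
  [/\ (size q <= d.+1)%N, q`_d = top_coef.@[x]
    & forall a, q.[a] = c.@[fun i => if i == m then a else x i]].
Proof.
pose f (v : 'X_{1..n}) := c@_v * \prod_(i < n | i != m) x i ^+ v i.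
exists (\sum_(v <- msupp c) f v *: 'X^(v m)); split.
- rewrite big_seq; apply: (leq_trans (size_sum _ _ _)).
  apply/bigmax_leqP_seq => v vc _; apply: leq_trans (size_scale_leq _ _) _.
  by rewrite size_polyXn ltnS leq_lexlead_top.
- rewrite coef_sum raddf_sum /= [RHS]big_mkcond; apply: eq_bigr => v _ /=.
  rewrite coefZ coefXn eq_sym; case: eqP => [vm|_]; last by rewrite mulr0.
  rewrite mulr1 mevalZ mevalX (bigD1 m) //= mnmBE eE eqxx vm subnn expr0 mul1r.
  congr (_ * _); apply: eq_bigr => i /negPf neq_im.
  by rewrite mnmBE eE neq_im subn0.
- move=> a; rewrite horner_sum mevalE; apply: eq_bigr => v _.
  rewrite hornerZ hornerXn [in RHS](bigD1 m) //= eqxx -mulrA; congr (_ * _).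
  by rewrite mulrC; congr (_ * _); apply: eq_bigr => i /negPf->.
Qed.

End TopCoefficient.

(** The list [s] is arbitrary because the induction on [m] passes to a sublist, the points with
    large fibres, together with the top coefficient of [c]. *)
Lemma triangular_factors (n : nat) (k : fieldType) (m : nat)
    (s : seq 'rV[k]_n) (c : {mpoly k[n]}) :
    (m <= n)%N -> in_first_variables m c -> c != 0 ->
    (forall P, P \in s -> c.@[fun i => P 0 i] = 0) ->
  exists g : 'I_n -> nat -> {mpoly k[n]},
    (forall (j : 'I_n) delta, in_first_variables j (g j delta)) /\
    (forall P, P \in s -> exists j delta,
       (1 <= delta <= lexlead c j)%N /\ P 0 j = (g j delta).@[fun i => P 0 i]).
Proof.
elim: m s c => [|m IHm] s c.
  move=> _ c_first c0 c_s; exists (fun _ _ => 0); split.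
    by move=> j delta; rewrite -mpolyC0; exact: in_first_variablesC.
  (* Without variables [c] is a nonzero constant, so it has no zeros and [s] is empty. *)
  have c_const : c = (c@_0)%:MP.
    apply/mpolyP => u; rewrite mcoeffC; case: eqVneq => [->|u_neq0].
      by rewrite mulr1.
    rewrite mulr0; apply: memN_msupp_eq0.
    apply: contra_neqN u_neq0 => /c_first u0.
    by apply/mnmP => j; rewrite u0 ?mnm0E.
  move=> P /c_s; rewrite c_const mevalC => c00.
  by rewrite c_const c00 mpolyC0 eqxx in c0.
move=> lt_mn c_first c0 c_s.
pose i0 := Ordinal lt_mn; pose d := lexlead c i0.
(* Duplicates are removed so that the listed values count as distinct roots. *)
pose fibre P := undup [seq Q 0 i0 | Q : 'rV_n <- s & agree m P Q].
have fibre_agree P Q : agree m P Q -> fibre P = fibre Q.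
  move=> PQ; congr (undup (map _ _)); apply: eq_filter => S.
  by rewrite (agree_trans PQ).
pose big_s := [seq P <- s | (d < size (fibre P))%N].
have [P|g [g_first g_s]] := IHm big_s (top_coef i0 c) (ltnW lt_mn)
    (@top_coef_first _ _ i0 _ c_first) (top_coef_neq0 _ c0).
  rewrite mem_filter => /andP[big_P Ps].
  have [q [size_q <- qE]] :=
    @top_coef_univariate _ _ i0 _ c_first c0 (fun i => P 0 i).
  (* The degree of [q] is at most [d], yet each of the more than [d] values in the fibre is a
     root. *)
  suff -> : q = 0 by rewrite coef0.
  apply: (roots_geq_poly_eq0 _ (undup_uniq _) (leq_trans size_q big_P)).
  apply/allP => a; rewrite mem_undup => /mapP[Q]; rewrite mem_filter.
  case/andP=> /agreeP PQ Qs ->; rewrite /root qE -[X in _ == X](c_s _ Qs).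
  apply/eqP; apply: meval_first c_first _ => j /=; rewrite ltnS leq_eqVlt.
  case: (eqVneq j i0) => [->//|neq_j].
  by rewrite (negPf (neq_j : j != m :> nat)) => /PQ.
(* The entry of the fibre at position [delta], with default 0 past its end, depends only on the
   first [m] coordinates. *)
have /fin_all_exists[h h_s] (delta : 'I_d) : exists h, in_first_variables m h /\
    forall P, P \in s -> h.@[fun i => P 0 i] = (fibre P)`_delta.
  by apply: interpolation => P Q /fibre_agree->.
(* Factors are numbered from 1, positions in the fibre from 0. *)
pose h' delta : {mpoly k[n]} := if insub delta.-1 is Some i then h i else 0.
have h'_first delta : in_first_variables m (h' delta).
  rewrite /h'; case: insubP => [i _ _|_]; first by case: (h_s i).
  by rewrite -mpolyC0; exact: in_first_variablesC.
exists (fun j delta => if j == i0 then h' delta else g j delta); split.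
  by move=> j delta; case: eqVneq => // ->.
move=> P Ps; have [big_P|small_P] := ltnP d (size (fibre P)).
  have [|j [delta [ltd Pj]]] := g_s P; first by rewrite mem_filter big_P.
  exists j, delta; rewrite lexlead_top_coef // mnmBE mulmnE mnm1E eq_sym in ltd.
  (* The top coefficient has leading exponent 0 in [i0], so its factors never use that variable and
     [h'] overrides none of them. *)
  move: ltd; case: eqVneq => [->|neq_j].
    by rewrite mul1n subnn; case: (delta).
  by rewrite subn0; split.
have in_fibre : P 0 i0 \in fibre P.
  by rewrite mem_undup; apply/mapP; exists P; rewrite // mem_filter agree_refl.
(* A fibre of at most [d] elements is exhausted by the positions below [d]. *)
exists i0, (index (P 0 i0) (fibre P)).+1; rewrite eqxx /h' /=.
have lt_d : (index (P 0%R i0) (fibre P) < d)%N.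
  by apply: leq_trans small_P; rewrite index_mem.
rewrite insubT /=; split=> //.
by case: (h_s (Ordinal lt_d)) => _ ->//=; rewrite nth_index.
Qed.

(** * Assembly of the Groebner basis *)

Lemma lexlead_sub_first (n : nat) (k : fieldType) (m : 'I_n)
    (g : {mpoly k[n]}) :
    in_first_variables m g ->
  'X_m - g != 0 /\ lexlead ('X_m - g) = U_(m)%MM.
Proof.
move=> g_first; have supp_m : U_(m)%MM \in msupp ('X_m - g).
  rewrite mcoeff_msupp mcoeffB mcoeffX eqxx.
  rewrite (memN_msupp_eq0 (p := g)) ?subr0 ?oner_neq0 //.
  by apply/negP => /g_first/(_ m (leqnn m)); rewrite mnm1E eqxx.
split; first by apply: contraTneq supp_m => ->; rewrite msupp0.
apply: lexlead_eq => // v /msuppB_le; rewrite mem_cat msuppX mem_seq1.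
case/orP=> [->//|/g_first v_first _]; apply/lexltP.
exists m; first by rewrite v_first // mnm1E eqxx.
move=> i lt_mi; rewrite v_first ?(ltnW lt_mi) // mnm1E.
by case: eqVneq lt_mi => // ->; rewrite ltnn.
Qed.

(** A proper divisor has smaller total degree, so descent terminates. As [S] is an arbitrary
    predicate, the case split is classical. *)
Lemma minimal_basis_below (n : nat) (S : 'X_{1..n} -> Prop) (u : 'X_{1..n}) :
  S u -> exists2 v, minimal_basis S v & (v <= u)%MM.
Proof.
have [d] := ubnP (mdeg u); elim: d u => // d IHd u; rewrite ltnS => le_ud Su.
have [[v [Sv le_vu neq_vu]]|u_min] :=
    classic (exists v, [/\ S v, (v <= u)%MM & v != u]); last first.
  exists u; rewrite ?lepm_refl //; split=> // v Sv le_vu.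
  by case: (eqVneq v u) => // neq_vu; case: u_min; exists v.
have lt_vu : (mdeg v < mdeg u)%N.
  rewrite -(submK le_vu) mdegD -[ltnLHS]add0n ltn_add2r lt0n mdeg_eq0.
  apply: contraNneq neq_vu => eq0.
  by rewrite -(submK le_vu) eq0 add0m eqxx.
have [w w_min le_wv] := IHd v (leq_trans lt_vu le_ud) Sv.
by exists w; rewrite // (lepm_trans le_wv).
Qed.

Theorem theorem5p1 (k : fieldType) (n : nat) (X : {fset 'rV[k]_n})
    (X_nonempty : X != fset0)
    (r : nat) (t : 'I_r -> 'X_{1..n})
    (t_inj : injective t)
    (t_enum : forall u : 'X_{1..n},
       minimal_basis (lead_terms (vanishing_ideal X)) u <-> exists i, t i = u) :
  exists g : 'I_n -> nat -> 'I_r -> {mpoly k[n]},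
    (forall (m : 'I_n) (delta : nat) (i : 'I_r),
       (1 <= delta <= t i m)%N -> in_first_variables m (g m delta i)) /\
    minimal_groebner_basis (vanishing_ideal X)
      (fun f => exists i : 'I_r,
         f = \prod_(m < n) \prod_(1 <= delta < (t i m).+1)
               ('X_m - g m delta i)).
Proof.
have lead_t i : lead_terms (vanishing_ideal X) (t i).
  by have [] := (t_enum (t i)).2 (ex_intro _ i erefl).
have factors i : exists g : 'I_n -> nat -> {mpoly k[n]},
    (forall (j : 'I_n) delta, in_first_variables j (g j delta)) /\
    (forall P, P \in X -> exists j delta,
       (1 <= delta <= t i j)%N /\ P 0 j = (g j delta).@[fun i => P 0 i]).
  have [c [c_X c0 <-]] := lead_t i.
  apply: (@triangular_factors _ _ n (enum_fset X) c) => // u _ j.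
  by rewrite leqNgt ltn_ord.
have [g g_i] := fin_all_exists factors.
have g_first i (j : 'I_n) delta : in_first_variables j (g i j delta).
  by case: (g_i i).
exists (fun m delta i => g i m delta); split=> [m delta i _ //|].
pose f i := \prod_(m < n) \prod_(1 <= delta < (t i m).+1) ('X_m - g i m delta).
have factor0 i (m : 'I_n) delta : 'X_m - g i m delta != 0.
  by case: (lexlead_sub_first (g_first i m delta)).
have prod0 i (m : 'I_n) :
    \prod_(1 <= delta < (t i m).+1) ('X_m - g i m delta) != 0.
  by elim/big_ind: _ => // [|x y]; [exact: oner_neq0 | exact: mulf_neq0].
have f0 i : f i != 0 by apply/prodf_neq0.
(* Each of the [t i m] factors for the variable [m] contributes the leading term [U_(m)]. *)
have f_lead i : lexlead (f i) = t i.
  rewrite lexlead_prod // [RHS]multinomUE_id; apply: eq_bigr => m _.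
  rewrite lexlead_prod // (eq_bigr (fun=> U_(m)%MM)) => [|delta _].
    apply/mnmP => j.
    by rewrite mnm_sumE sum_nat_const_nat subn1 mulmnE mulnC.
  by case: (lexlead_sub_first (g_first i m delta)).
have f_X i : vanishing_ideal X (f i).
  move=> P PX; have [_ /(_ P PX)[j [delta [le_delta Pj]]]] := g_i i.
  rewrite rmorph_prod (bigD1 j) //= rmorph_prod.
  rewrite (bigD1_seq delta) ?iota_uniq //=.
    by rewrite mevalB mevalXU Pj subrr !mul0r.
  by rewrite mem_index_iota.
split; last first.
  move=> _ _ [i ->] [j ->] neq; rewrite -!/(f _) !f_lead; apply/negP => le_ij.
  have [_ min_tj] := (t_enum (t j)).2 (ex_intro _ j erefl).
  (* Minimality of [t j] turns divisibility into equality, and injectivity identifies the two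
     polynomials. *)
  have /t_inj eq_ij := min_tj _ (lead_t i) le_ij.
  by rewrite eq_ij in neq.
split=> [_ [i ->]|u]; first by split; [exact: f_X | exact: f0].
split=> [[_ [_ [[i ->] _ <-]]]|]; last first.
  move=> /minimal_basis_below[v /t_enum[i <-] le_iu].
  by exists (t i) => //; exists (f i); split=> //; exists i.
(* Multiplying [f i] by the complementary term realises [u] as a leading term of the ideal. *)
rewrite -/(f i) => le_u; exists (f i * 'X_[u - lexlead (f i)]).
have X0 : 'X_[u - lexlead (f i)] != 0 :> {mpoly k[n]}.
  by rewrite -msupp_eq0 msuppX.
split; first by move=> P /(f_X i); rewrite mevalM => ->; rewrite mul0r.
  by rewrite mulf_neq0.
rewrite lexleadM // [X in (_ + X)%MM](_ : _ = u - lexlead (f i))%MM.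
  by rewrite addmC submK.
by apply: lexlead_eq => [|w]; rewrite msuppX mem_seq1 // => ->.
Qed.
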